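(* Let $\mathcal{I}$ be an ideal on $\omega$ for which there exists an uncountable $\mathcal{I}$-mad family. Then $c_0(\mathcal{I}) \cap \ell_\infty$ is not complemented in $\ell_\infty$.
   Context: An ideal on $\omega$ is a family $\mathcal{I}\subseteq\mathcal{P}(\omega)$ closed under subsets and finite unions; it is also assumed that every finite subset of $\omega$ belongs to $\mathcal{I}$ and that $\omega\notin\mathcal{I}$. Set $\mathcal{I}^+:=\mathcal{P}(\omega)\setminus\mathcal{I}$. A family $\mathscr{A}\subseteq\mathcal{I}^+$ is $\mathcal{I}$-maximal-almost-disjoint ($\mathcal{I}$-mad) if it is maximal, with respect to inclusion, among the families $\mathscr{A}\subseteq\mathcal{I}^+$ such that $A\cap B\in\mathcal{I}$ for all distinct $A,B\in\mathscr{A}$. A real sequence $(x_n)_{n\in\omega}$ is $\mathcal{I}$-convergent to $y\in\mathbb{R}$ if $\{n: x_n\notin U\}\in\mathcal{I}$ for every neighborhood $U$ of $y$. $c_0(\mathcal{I})$ is the space of real sequences that are $\mathcal{I}$-convergent to $0$. $\ell_\infty$ is the Banach space of bounded real sequences indexed by $\omega$ with the sup norm; $c_0(\mathcal{I})\cap\ell_\infty$ is a closed linear subspace of it. A closed subspace $X$ of a Banach space $B$ is complemented in $B$ if there exists a continuous (linear) projection from $B$ onto $X$. *)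

(* Defs.v *)
From HB Require Import structures.
From mathcomp Require Import all_boot all_order all_algebra.
From mathcomp Require Import all_classical all_reals.
From mathcomp Require Import topology normedtype sequences.

Set Implicit Arguments.
Unset Strict Implicit.
Unset Printing Implicit Defensive.

Import Order.TTheory GRing.Theory Num.Theory.
Import numFieldNormedType.Exports.

Local Open Scope classical_set_scope.
Local Open Scope ring_scope.

Record is_ideal (I : set_system nat) : Prop := IsIdeal {
  ideal_sub : forall A B : set nat, A `<=` B -> I B -> I A ;
  ideal_setU : forall A B : set nat, I A -> I B -> I (A `|` B) ;
  ideal_finite : forall A : set nat, finite_set A -> I A ;
  ideal_proper : ~ I [set: nat]
}.

Definition almost_disjoint (I AA : set_system nat) : Prop :=
  AA `<=` ~` I /\ forall A B, AA A -> AA B -> A <> B -> I (A `&` B).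

Definition mad (I AA : set_system nat) : Prop :=
  almost_disjoint I AA /\
  forall BB : set_system nat, almost_disjoint I BB -> AA `<=` BB -> BB = AA.

Definition ideal_cvg (I : set_system nat) (R : realType) (x : nat -> R) (y : R)
  : Prop := forall U : set R, nbhs y U -> I [set n | ~ U (x n)].

Definition c0 (I : set_system nat) (R : realType) : set (nat -> R) :=
  [set x | ideal_cvg I x 0].

Definition bounded_seq (R : realType) : {pred nat -> R} :=
  mem [set x : nat -> R | bounded_fun x].

Record linfty (R : realType) := Linfty {
  linfty_val :> nat -> R ;
  linfty_valP : linfty_val \in @bounded_seq R
}.

Section linfty_lmodule.
Variable R : realType.
Implicit Types x y : nat -> R.

HB.instance Definition _ := [isSub for @linfty_val R].
HB.instance Definition _ := [Choice of linfty R by <:].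

Lemma bounded_seqP x :
  reflect (exists M, forall n, `|x n| <= M) (x \in @bounded_seq R).
Proof.
have [bP Pb] := @ex_bound _ R R^o x (globally setT)
  (globally_properfilter (a := 0%N) Logic.I).
apply: (iffP idP) => [|[M xM]]; rewrite /bounded_seq inE /=.
  by move=> /bP[M xM]; exists M => n; exact: xM.
by apply: Pb; exists M => n _; exact: xM.
Qed.

Lemma bounded_seq_submod_closed : submod_closed (@bounded_seq R).
Proof.
split; first by apply/bounded_seqP; exists 0 => n; rewrite normr0.
move=> a x y /bounded_seqP[M xM] /bounded_seqP[N yN].
apply/bounded_seqP; exists (`|a| * M + N) => n.
apply: (le_trans (ler_normD _ _)); rewrite lerD// normrM.
by rewrite ler_wpM2l.
Qed.

HB.instance Definition _ := GRing.isSubmodClosed.Build R (nat -> R)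
  (@bounded_seq R) bounded_seq_submod_closed.
HB.instance Definition _ := [SubChoice_isSubLmodule of linfty R by <:].

End linfty_lmodule.

Definition linfty_norm (R : realType) (x : linfty R) : R :=
  sup (range (fun n => `|x n|)).

Section linfty_normed.
Variable R : realType.
Implicit Types x y : linfty R.

Lemma linfty_has_ubound x : has_ubound (range (fun n => `|x n|)).
Proof.
have /bounded_seqP[M xM] := linfty_valP x.
by exists M => _ [n _ <-]; exact: xM.
Qed.

Lemma le_linfty_norm x n : `|x n| <= linfty_norm x.
Proof. by apply: ub_le_sup; [exact: linfty_has_ubound|exists n]. Qed.

Lemma linfty_norm_le x M : (forall n, `|x n| <= M) -> linfty_norm x <= M.
Proof.
move=> xM; apply: ge_sup; first by exists `|x 0%N|; exists 0%N.
by move=> _ [n _ <-]; exact: xM.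
Qed.

Lemma linfty_normD x y : linfty_norm (x + y) <= linfty_norm x + linfty_norm y.
Proof.
apply: linfty_norm_le => n; apply: (le_trans (ler_normD _ _)).
by rewrite lerD// le_linfty_norm.
Qed.

Lemma linfty_normZ (a : R) x : linfty_norm (a *: x) = `|a| * linfty_norm x.
Proof.
have le_normZ (b : R) (z : linfty R) : linfty_norm (b *: z) <= `|b| * linfty_norm z.
  by apply: linfty_norm_le => n; rewrite normrM ler_wpM2l// le_linfty_norm.
apply/eqP; rewrite eq_le le_normZ/=; have [->|a0] := eqVneq a 0.
  by rewrite normr0 mul0r (le_trans (normr_ge0 _) (le_linfty_norm _ 0%N)).
rewrite -ler_pdivlMl ?normr_gt0// -normfV.
by rewrite (le_trans _ (le_normZ _ _))// scalerK.
Qed.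

Lemma linfty_norm0_eq0 x : linfty_norm x = 0 -> x = 0.
Proof.
move=> x0; apply/val_inj/funext => n; apply/eqP.
by rewrite -normr_le0 -x0 le_linfty_norm.
Qed.

HB.instance Definition _ := @Lmodule_isNormed.Build R (linfty R)
  (@linfty_norm R) linfty_normD linfty_normZ linfty_norm0_eq0.

End linfty_normed.

Section linfty_complete.
Variable R : realType.

Lemma linfty_ball (x y : linfty R) (e : R) (n : nat) :
  ball x e y -> `|x n - y n| < e.
Proof. by rewrite -ball_normE; apply/le_lt_trans/(le_linfty_norm (x - y)). Qed.

Lemma linfty_cauchy_cvg (F : set_system (linfty R)) :
  ProperFilter F -> cauchy F -> cvg F.
Proof.
move=> FF /cauchyP Fc.
have coord_cvg n : cvg ((fun x : linfty R => x n) @ F).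
  apply/cauchy_cvgP/cauchyP => e /Fc[x Fx]; exists (x n).
  apply: (@filterS _ F _ (ball x e)) Fx => y xy.
  by rewrite /= -ball_normE; exact: linfty_ball.
pose l n := lim ((fun x : linfty R => x n) @ F).
have dist_l x e : F (ball x e) -> forall n, `|x n - l n| <= e.
  move=> Fx n; apply/ler_addgt0Pr => d d0.
  have /cvgrPdist_lt/(_ d d0) Fl := coord_cvg n.
  have [z [/(@linfty_ball _ _ _ n) xz lz]] := filter_ex (filterI Fx Fl).
  rewrite -(subrKA (z n)) (le_trans (ler_normD _ _))// lerD ?ltW//.
  by rewrite distrC.
have lb : l \in @bounded_seq R.
  have [x Fx] := Fc 1 ltr01.
  apply/bounded_seqP; exists (linfty_norm x + 1) => n.
  rewrite -[l n](subKr (x n)) (le_trans (ler_normB _ _))//.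
  by rewrite lerD// ?le_linfty_norm// dist_l.
apply/cvg_ex; exists (Linfty lb); apply/cvgrPdist_le => e e0.
have [x Fx] := Fc (e / 2) (divr_gt0 e0 (ltr0Sn R 1)).
apply: filterS (Fx) => y xy.
apply: linfty_norm_le => n.
rewrite (_ : (_ - y) n = l n - y n)// -(subrKA (x n)) (splitr e).
rewrite (le_trans (ler_normD _ _))// lerD//.
  by rewrite distrC dist_l.
by rewrite ltW// linfty_ball.
Qed.

HB.instance Definition _ := Uniform_isComplete.Build (linfty R)
  linfty_cauchy_cvg.

End linfty_complete.

(* The equation [range P = X] for a continuous linear projection [P] forces [X]
   to be a closed linear subspace, so this need not be required separately. *)
Definition complemented (K : numFieldType) (B : completeNormedModType K)
    (X : set B) : Prop :=
  exists P : {linear B -> B}, [/\ continuous P, forall x, P (P x) = P x & range P = X].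

Definition c0_linfty (I : set_system nat) (R : realType) : set (linfty R) :=
  [set x : linfty R | c0 I (x : nat -> R)].
Arguments c0_linfty I R : clear implicits.

Section c0_closed_subspace.
Variables (R : realType) (I : set_system nat).
Hypothesis hI : is_ideal I.

Lemma c0P (x : nat -> R) :
  c0 I x <-> forall e, 0 < e -> I [set n | e <= `|x n|].
Proof.
split=> [x0 e e0|x0 U /nbhs_ballP[e /= e0 eU]].
  apply: (ideal_sub hI) (x0 _ (nbhsx_ballx 0 e e0)) => n /= ex.
  by rewrite -ball_normE /= sub0r normrN; apply/negP; rewrite -leNgt.
apply: (ideal_sub hI) (x0 e e0) => n /= nU; rewrite leNgt; apply/negP => xe.
by apply/nU/eU; rewrite -ball_normE /= sub0r normrN.
Qed.

Lemma c0_linfty_submod : submod_closed (mem (c0_linfty I R)).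
Proof.
split.
  rewrite inE; apply/c0P => e e0; apply: (ideal_finite hI).
  rewrite (_ : [set _ | _] = set0)//; apply/seteqP; split=> n //=.
  by rewrite normr0 leNgt e0.
move=> a x y; rewrite !inE => /c0P x0 /c0P y0; apply/c0P => e e0.
have d0 : 0 < e / 2 / (`|a| + 1).
  by rewrite !divr_gt0// ltr_wpDl.
apply: (ideal_sub hI) (ideal_setU hI (x0 _ d0) (y0 _ (divr_gt0 e0 (ltr0Sn R 1)))).
move=> n /= exy; have [|yn] := leP (e / 2) `|y n|; [by right|left].
rewrite leNgt; apply/negP => xn; move: exy; apply/negP; rewrite -ltNge.
rewrite (splitr e) (le_lt_trans (ler_normD _ _))// ler_ltD// normrM.
rewrite ltr_pdivlMr ?ltr_wpDl// in xn.
by rewrite ltW// (le_lt_trans _ xn)// mulrC ler_wpM2l// lerDl.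
Qed.

Lemma c0_linfty_closed : closed (c0_linfty I R).
Proof.
move=> x xcl; apply/c0P => e e0.
have [y [/c0P y0 xy]] := xcl _ (nbhsx_ballx x (e / 2) (divr_gt0 e0 (ltr0Sn R 1))).
apply: (ideal_sub hI) (y0 _ (divr_gt0 e0 (ltr0Sn R 1))) => n /= ex.
rewrite leNgt; apply/negP => yn; move: ex; apply/negP; rewrite -ltNge.
rewrite -[x n](subrK (y n)) (splitr e) (le_lt_trans (ler_normD _ _))//.
by rewrite ltrD// linfty_ball.
Qed.

End c0_closed_subspace.

(* Main.v *)
Require Import Defs.
From HB Require Import structures.
From mathcomp Require Import all_boot all_order all_algebra finmap.
From mathcomp Require Import all_classical all_reals.
From mathcomp Require Import topology normedtype sequences.

(** The argument is Whitley's proof that c_0 is not complemented in l_oo,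
    carried out relative to an ideal.

    If [P] were a continuous projection of l_oo onto the bounded I-null
    sequences, then [id - P] would be a continuous operator whose kernel is
    exactly that subspace, i.e. the subspace would be cut out by the countably
    many continuous functionals [x |-> (x - P x) n]. An uncountable almost
    disjoint family forbids this: the indicator of an I-positive set is not
    I-null, so each member of the family is detected by one of these
    functionals, whereas a single one detects only countably many members
    ([countable_functional_indic_neq0]).

    The reason for the latter is that the indicators of an almost disjoint
    family are pairwise disjoint modulo I-null sequences. A linear combination
    of finitely many of them with coefficients of modulus at most 1 therefore
    agrees with an element of the unit ball up to an I-null sequence
    ([normr_sum_indic_le1], [functional_normr_le]). Taking the signs of the
    values of a functional [f] as coefficients, the sum of [`|f 1_A|] over
    finitely many members [A] is at most the norm of [f], so that for every
    [e > 0] only finitely many of these values reach [e]. *)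

Set Implicit Arguments.
Unset Strict Implicit.
Unset Printing Implicit Defensive.

Import Order.TTheory GRing.Theory Num.Theory.
Import numFieldNormedType.Exports.

Local Open Scope classical_set_scope.
Local Open Scope ring_scope.

Lemma ideal_bigcup (I : set_system nat) (J : choiceType) (D : set J)
    (F : J -> set nat) :
    is_ideal I -> finite_set D -> (forall j, D j -> I (F j)) ->
  I (\bigcup_(j in D) F j).
Proof.
move=> hI /finite_fsetP[X ->] IF; rewrite bigcup_fset big_seq.
apply: (big_ind I) => [|A B|j jX].
- by apply: (ideal_finite hI); exact: finite_set0.
- exact: ideal_setU.
- exact: IF.
Qed.

Section bounded_sequences.
Variable R : realType.
Implicit Types (x : linfty R) (A : set nat).

Definition linfty_coord (n : nat) x : R^o := x n.

Lemma linfty_coord_linear n : linear (linfty_coord n).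
Proof. by []. Qed.

HB.instance Definition _ n := GRing.isLinear.Build R (linfty R) R^o *:%R
  (linfty_coord n) (linfty_coord_linear n).

Lemma linfty_coord_continuous n : continuous (linfty_coord n).
Proof.
apply/linear_bounded_continuous/bounded_funP => r; exists r => x.
by apply: le_trans; exact: le_linfty_norm.
Qed.

Lemma restrict_bounded A x : (x : nat -> R) \_ A \in @bounded_seq R.
Proof.
apply/bounded_seqP; exists (linfty_norm x) => n; rewrite patchE.
case: ifP => _; first exact: le_linfty_norm.
by rewrite normr0 (le_trans (normr_ge0 (x 0%N))) ?le_linfty_norm.
Qed.

Definition linfty_restrict A x : linfty R := Linfty (restrict_bounded A x).

Lemma cst1_bounded : (fun=> 1 : R) \in @bounded_seq R.
Proof. by apply/bounded_seqP; exists 1 => n; rewrite normr1. Qed.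

Definition linfty_indic A : linfty R := linfty_restrict A (Linfty cst1_bounded).

Lemma linfty_indicE A n : linfty_indic A n = (n \in A)%:R.
Proof. by rewrite /= patchE; case: ifP. Qed.

End bounded_sequences.

Section ideal_null_sequences.
Variables (R : realType) (I : set_system nat).
Hypothesis hI : is_ideal I.
Implicit Types (x : linfty R) (A : set nat).

Lemma c0_linfty_supported A x :
  I A -> (forall n, ~ A n -> x n = 0) -> c0_linfty I R x.
Proof.
move=> IA x0; apply/(c0P hI) => e e0; apply: (ideal_sub hI) IA => n /= ex.
apply: contrapT => /x0 xn0; move: ex.
by rewrite xn0 normr0 leNgt e0.
Qed.

Lemma c0_linfty_indic A : c0_linfty I R (linfty_indic R A) -> I A.
Proof.
move=> /(c0P hI)/(_ 1 ltr01); apply: (ideal_sub hI) => n An.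
by rewrite /mkset linfty_indicE mem_set// normr1.
Qed.

(** A bound holding off a set of the ideal is as good as a uniform bound,
    because the restriction of [x] to that set is I-null. *)
Lemma functional_normr_le (f : {linear linfty R -> R^o}) (M : R) A x :
    (forall y, c0_linfty I R y -> f y = 0) ->
    (forall y, `|y| <= 1 -> `|f y| <= M) ->
    I A -> (forall n, ~ A n -> `|x n| <= 1) ->
  `|f x| <= M.
Proof.
move=> f0 fM IA x1; pose y := linfty_restrict (~` A) x.
have -> : f x = f y.
  apply/eqP; rewrite -subr_eq0 -linearB; apply/eqP/f0.
  apply: (c0_linfty_supported IA) => n nA.
  rewrite -/(linfty_coord n _) linearB /= /linfty_coord /=.
  by rewrite patchT ?subrr// inE.
apply/fM/linfty_norm_le => n; rewrite /= patchE; case: ifPn.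
  by rewrite inE; exact: x1.
by rewrite normr0 ler01.
Qed.

(** Off the pairwise intersections of the sets in [B], at most one term of the
    sum is nonzero. *)
Lemma normr_sum_indic_le1 (B : {fset set nat}) (c : set nat -> R) n :
    (forall A, `|c A| <= 1) ->
    (forall A A', A \in B -> A' \in B -> A n -> A' n -> A = A') ->
  `|(\sum_(A <- B) c A *: linfty_indic R A) n| <= 1.
Proof.
move=> c1 Bn; have termE A : linfty_coord n (c A *: linfty_indic R A) = c A *: (n \in A)%:R.
  by rewrite linearZ; congr (_ *: _); exact: linfty_indicE.
rewrite -/(linfty_coord n _) linear_sum (eq_bigr _ (fun A _ => termE A)).
have [[A0 A0B A0n]|noA] := pselect (exists2 A, A \in B & A n).
  rewrite (big_rem A0)//= big_seq big1 ?addr0 => [|A].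
    by rewrite mem_set// /GRing.scale /= mulr1.
  rewrite mem_rem_uniq ?fset_uniq// inE => /andP[AA0 AB].
  rewrite memNset ?scaler0// => An.
  by move/eqP: AA0; apply; exact: Bn.
rewrite big_seq big1 ?normr0 ?ler01// => A AB.
by rewrite memNset ?scaler0// => An; apply: noA; exists A.
Qed.

Section almost_disjoint_family.
Variable AA : set_system nat.
Hypothesis adAA : almost_disjoint I AA.
Variable f : {linear linfty R -> R^o}.
Hypotheses (f_cont : continuous f) (f0 : forall x, c0_linfty I R x -> f x = 0).

(** The signs of the values make the contributions add up, so the norm of [f]
    limits how many of them can reach [e]. *)
Lemma finite_functional_indic_ge (e : R) : 0 < e ->
  finite_set [set A | AA A /\ e <= `|f (linfty_indic R A)|].
Proof.
move=> e0; apply: contrapT => /infinite_set_fsetP large.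
have /linear_bounded_continuous/bounded_funP/(_ 1)[M fM] := f_cont.
(* With more than [M / e] members, the signed sum would be sent above [M]. *)
have [B BAA Bcard] := large (Num.bound (M / e)).
have BA A : A \in B -> AA A by move=> /BAA[].
pose c A := Num.sg (f (linfty_indic R A)).
pose D := [set p | p.1 \in B /\ p.2 \in B /\ p.1 <> p.2] : set (set nat * set nat).
have fsum : f (\sum_(A <- B) c A *: linfty_indic R A) =
            \sum_(A <- B) `|f (linfty_indic R A)|.
  rewrite linear_sum; apply: eq_bigr => A _.
  by rewrite linearZ normrEsg.
have fsumM : `|f (\sum_(A <- B) c A *: linfty_indic R A)| <= M.
  apply: (@functional_normr_le _ _ (\bigcup_(p in D) (p.1 `&` p.2))) => //.
    apply: ideal_bigcup => // [|p [pB [qB pq]]].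
      apply: (sub_finite_set (B := [set` B] `*` [set` B])).
        by move=> p [pB [qB _]].
      exact: finite_setX.
    by case: adAA => _; apply=> //; exact: BA.
  move=> n nD; apply: normr_sum_indic_le1 => [A|A A' AB A'B An A'n].
    by rewrite normr_sg lern1 leq_b1.
  by apply: contrapT => AA'; apply: nD; exists (A, A').
move: fsumM; rewrite fsum; apply/negP; rewrite -ltNge.
apply: (lt_le_trans _ (ler_norm _)).
apply: (@lt_le_trans _ _ (\sum_(A <- B) e)); last first.
  by rewrite big_seq [leRHS]big_seq; apply: ler_sum => A /BAA[].
rewrite big_const_seq count_predT iter_addr_0 -mulr_natl -ltr_pdivrMr//.
have M0 : 0 <= M / e.
  by rewrite divr_ge0 ?(ltW e0)// (le_trans _ (fM 0 _)) ?normr0 ?ler01.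
by rewrite (lt_le_trans (archi_boundP M0))// ler_nat.
Qed.

Lemma countable_functional_indic_neq0 :
  countable [set A | AA A /\ f (linfty_indic R A) <> 0].
Proof.
pose F k := [set A | AA A /\ k.+1%:R^-1 <= `|f (linfty_indic R A)|].
apply: (sub_countable (B := \bigcup_k F k)); last first.
  apply: bigcup_countable => // k _; apply: finite_set_countable.
  by apply: finite_functional_indic_ge; rewrite invr_gt0.
apply: subset_card_le => A [AAA /eqP]; rewrite -normr_gt0 => fA.
exists (Num.bound `|f (linfty_indic R A)|^-1) => //; split=> //.
rewrite invf_ple ?posrE// ltW// (lt_le_trans (archi_boundP _)) ?ler_nat//.
by rewrite invr_ge0.
Qed.

End almost_disjoint_family.

End ideal_null_sequences.

Theorem theorem1p2 (R : realType) (I : set_system nat) (hI : is_ideal I)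
    (hmad : exists AA : set_system nat, mad I AA /\ ~ countable AA) :
  ~ complemented (c0_linfty I R).
Proof.
case: hmad => AA [[adAA _] AAuncountable] [P [P_cont PP rangeP]].
apply: AAuncountable.
pose f n : {linear linfty R -> R^o} := linfty_coord n \o (idfun \- P).
apply: (sub_countable
    (B := \bigcup_n [set A | AA A /\ f n (linfty_indic R A) <> 0])); last first.
  apply: bigcup_countable => // n _.
  apply: (countable_functional_indic_neq0 hI) => // [x|x].
    apply: continuous_comp; last exact: linfty_coord_continuous.
    by apply: (@continuousB _ _ _ idfun P); [exact: cvg_id|exact: P_cont].
  rewrite -rangeP => -[y _ <-].
  by rewrite /f /= PP subrr.
apply: subset_card_le => A AAA; apply: contrapT => fA0.
have PA : linfty_indic R A - P (linfty_indic R A) = 0.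
  apply/val_inj/funext => n; apply: contrapT => fA.
  by apply: fA0; exists n.
case: adAA => /(_ A AAA) nIA _; apply/nIA/(@c0_linfty_indic R _ hI).
rewrite -rangeP; exists (linfty_indic R A) => //.
by apply/esym/eqP; rewrite -subr_eq0; exact/eqP.
Qed.
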